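(* Let $A$ be a semiring and let $cl$ be a closure operation of finite type on $\mathcal I$, the poset of all ideals of $A$ (ordered by inclusion). Then the set $$X:=\{I\in\mathcal I\mid I^{cl}=I\},$$ with the hull-kernel topology induced from $2^A$, is a spectral space.
   Context: A semiring is a nonempty set $A$ with operations $+,\cdot$ such that $(A,+)$ and $(A,\cdot)$ are commutative monoids (with identities $0$ and $1$), $(a+b)c=ac+bc$ and $0\cdot a=0$. An ideal is an additive submonoid $I$ with $AI\subseteq I$. A closure operation on a poset $P$ is a map $\mathrm{cl}:P\to P$ with $x\le\mathrm{cl}(x)$, $\mathrm{cl}(\mathrm{cl}(x))=\mathrm{cl}(x)$, and $x\le y\Rightarrow\mathrm{cl}(x)\le\mathrm{cl}(y)$. A closure operation $I\mapsto I^{cl}$ on $\mathcal I$ is of finite type if $I^{cl}=\bigcup\{J^{cl}\mid J\subseteq I,\ J\in\mathcal I,\ J\text{ finitely generated}\}$ for all $I\in\mathcal I$. The hull-kernel topology on $2^A$ has as open sub-basis the sets $D(F)=\{I\in2^A\mid F\not\subseteq I\}$, $F\subseteq A$ finite. A spectral space is a quasi-compact $T_0$ topological space in which finite intersections of quasi-compact open subsets are quasi-compact open, the quasi-compact open subsets form a basis, and every nonempty irreducible closed subset has a unique generic point. *)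

(* Defs.v *)
From HB Require Import structures.
From mathcomp Require Export all_boot all_order all_algebra.
From mathcomp Require Export all_classical all_reals all_analysis.

Set Implicit Arguments.
Unset Strict Implicit.
Unset Printing Implicit Defensive.

Import Order.TTheory GRing.Theory.
Local Open Scope classical_set_scope.
Local Open Scope ring_scope.

Section Ideals.
Variable A : comPzSemiRingType.

Definition is_ideal (I : set A) : Prop :=
  [/\ I 0, forall x y, I x -> I y -> I (x + y) & forall a x, I x -> I (a * x)].

Record ideal := Ideal { ideal_set :> set A; _ : `[< is_ideal ideal_set >] }.

HB.instance Definition _ := [isSub for ideal_set].
HB.instance Definition _ := [Choice of ideal by <:].
(* The order of [set A] is inclusion, so this orders ideals by inclusion. *)
HB.instance Definition _ :=
  [SubChoice_isSubPOrder of ideal by <: with set_display].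

Definition finitely_generated (J : ideal) : Prop :=
  exists2 F : set A, finite_set F & ideal_set J = smallest is_ideal F.

Definition finite_type (cl : ideal -> ideal) : Prop :=
  forall I : ideal,
    ideal_set (cl I) =
    \bigcup_(J in [set J : ideal | (J <= I)%O /\ finitely_generated J]) cl J.

End Ideals.

Definition closure_operation (d : Order.disp_t) (P : porderType d)
    (cl : P -> P) : Prop :=
  [/\ forall x, (x <= cl x)%O,
      forall x, cl (cl x) = cl x &
      {homo cl : x y / (x <= y)%O}].

(* The power set 2^A; the alias carries the hull-kernel topology. *)
Definition hull_kernel (A : Type) : Type := set A.

HB.instance Definition _ (A : Type) := Choice.copy (hull_kernel A) (set A).
HB.instance Definition _ (A : Type) :=
  @isSubBaseTopological.Build (hull_kernel A) (set A) (@finite_set A)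
    (fun F => [set I : set A | ~ F `<=` I]).

Definition irreducible (T : topologicalType) (F : set T) : Prop :=
  forall C D : set T, closed C -> closed D ->
    F `<=` C `|` D -> F `<=` C \/ F `<=` D.

Definition qc_open (T : topologicalType) (U : set T) : Prop :=
  compact U /\ open U.

Record spectral_space (T : topologicalType) : Prop := SpectralSpace {
  spectral_compact : compact [set: T];
  spectral_T0 : kolmogorov_space T;
  spectral_qc_openI : forall (n : nat) (U : 'I_n -> set T),
    (forall i, qc_open (U i)) -> qc_open (\bigcap_i U i);
  spectral_basis : basis (@qc_open T);
  spectral_generic : forall F : set T, F !=set0 -> irreducible F -> closed F ->
    exists! x : T, closure [set x] = F }.

Definition closed_ideals (A : comPzSemiRingType) (cl : ideal A -> ideal A) :
    set (hull_kernel A) :=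
  @ideal_set A @` [set I : ideal A | cl I = I].

(* Main.v *)
(** An ultrafilter [U] on the set [X] of [cl]-closed ideals has the limit
    [L = {a | a belongs to U-almost every I}].  Being an ideal is preserved by
    this limit, and so is being [cl]-closed, because finite type reduces
    membership in [cl L] to finitely many elements of [L].  For finite [F], the
    limit [L] lies in [D(F)] iff [U] contains [D(F)], so [X] is closed in the
    constructible topology of [2^A].  A T0 space with a basis whose members are
    decided in this way by a limit point of every ultrafilter is spectral. *)

From mathcomp Require Import finmap.
Require Import Defs.

Set Implicit Arguments.
Unset Strict Implicit.
Unset Printing Implicit Defensive.

Import Order.TTheory GRing.Theory.
Local Open Scope classical_set_scope.
Local Open Scope ring_scope.

Lemma ultra_setC T (U : set_system T) (O : set T) :
  UltraFilter U -> U (~` O) <-> ~ U O.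
Proof.
move=> UU; split=> [UnO UO|nUO]; last by case: (in_ultra_setVsetC O UU).
by have [x []] := filter_ex (filterI UO UnO).
Qed.

Section UltrafilterCriterion.
Variables (T : topologicalType) (B : set (set T)).
Hypothesis T0 : kolmogorov_space T.
Hypothesis B_basis : basis B.

(* [x] is then the limit of [U] in the constructible topology. *)
Definition patch_limit (U : set_system T) (x : T) :=
  forall O, B O -> U O <-> O x.

Hypothesis patch_limitP : forall U, UltraFilter U -> exists x, patch_limit U x.

Lemma basis_open (O : set T) : B O -> open O.
Proof. by case: B_basis => Bo _ /Bo. Qed.

Lemma basis_nbhs (x : T) (O : set T) :
  nbhs x O -> exists V, [/\ B V, V x & V `<=` O].
Proof. by case: B_basis => _ /(_ x) Bx /Bx[V [BV Vx] VO]; exists V. Qed.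

(** Closedness in the constructible topology, tested on ultrafilters. *)
Definition patch_closed (K : set T) :=
  forall U x, UltraFilter U -> patch_limit U x -> U K -> K x.

(** A patch limit is also a limit in the original, coarser topology, since every neighbourhood
    contains a basic one. *)
Lemma patch_closed_compact (K : set T) : patch_closed K -> compact K.
Proof.
rewrite compact_ultra => Kcl U UU UK; have [x Ux] := patch_limitP UU.
exists x; split; first exact: Kcl Ux UK.
move=> O /basis_nbhs[V [BV Vx VO]].
by apply: filterS VO _; apply/(Ux _ BV).
Qed.

(** Compactness yields a limit [y] of [U] in [K], possibly different from [x]. Any basic [V] around
    [y] belongs to [U], hence contains [x]; as [K] is open, [V] can be chosen inside [K]. *)
Lemma compact_patch_closed (K : set T) : qc_open K -> patch_closed K.
Proof.
move=> [+ oK] U x UU Ux UK; rewrite compact_ultra.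
case/(_ U UU UK) => y [Ky Uy].
have [V [BV Vy VK]] := basis_nbhs (open_nbhs_nbhs (conj oK Ky)).
apply: VK; apply/(Ux _ BV); apply: Uy.
by apply: open_nbhs_nbhs; split=> //; exact: basis_open.
Qed.

Lemma basis_patch_closed (O : set T) : B O -> patch_closed O.
Proof. by move=> BO U x UU Ux /(Ux _ BO). Qed.

Lemma basis_qc_open (O : set T) : B O -> qc_open O.
Proof.
move=> BO; split; first exact: patch_closed_compact (basis_patch_closed BO).
exact: basis_open.
Qed.

(* An ultrafilter refining the traces on [F] of the open sets meeting [F] has
   a patch limit, and this limit lies in [F] and in every basic open set that
   meets [F]. *)
Lemma irreducible_generic (F : set T) :
  F !=set0 -> irreducible F -> closed F -> exists x, closure [set x] = F.
Proof.
move=> [z Fz] Firr Fcl.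
pose G := filter_from [set O | open O /\ F `&` O !=set0] (setI F).
have GF : ProperFilter G.
  apply: filter_from_proper => [|O [] //]; apply: filter_from_filter.
    by exists setT; split; [exact: openT | exists z].
  move=> O V [oO [x [Fx Ox]]] [oV [y [Fy Vy]]]; exists (O `&` V).
    split; first exact: openI.
    (* Otherwise the complements of [O] and [V] would cover [F], and irreducibility would put [F]
       inside one of them. *)
    apply: contrapT => FOV0.
    have [||w Fw|nFO|nFV] := Firr (~` O) (~` V).
    - exact: open_closedC.
    - exact: open_closedC.
    - apply: contrapT => /not_orP[/contrapT Ow /contrapT Vw].
      by apply: FOV0; exists w.
    - exact: nFO x Fx Ox.
    - exact: nFV y Fy Vy.
  by move=> w [Fw [Ow Vw]].
have [U [UU GU]] := ultraFilterLemma GF.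
have [x Ux] := patch_limitP UU.
have UF : U F by apply: GU; exists setT => [|w [] //];
  split; [exact: openT | exists z].
have Fx : F x.
  apply: contrapT => nFx.
  have [V [BV Vx VF]] := basis_nbhs (open_nbhs_nbhs
    (conj (closed_openC Fcl) nFx)).
  by have [w [/VF]] := filter_ex (filterI (proj2 (Ux _ BV) Vx) UF).
exists x; apply/seteqP; split=> [|y Fy O /basis_nbhs[V [BV Vy VO]]].
  by rewrite closureE; apply: smallest_sub => // _ ->.
exists x; split=> //; apply: VO; apply/(Ux _ BV).
apply: GU; exists V => [|w [] //]; split; last by exists y.
exact: basis_open.
Qed.

Lemma kolmogorov_closure_inj (x y : T) :
  closure [set x] = closure [set y] -> x = y.
Proof.
move=> xy; apply/eqP/negPn/negP => /T0 [V].
have half (u v : T) : closure [set u] = closure [set v] ->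
    ~ (V \in nbhs u /\ v \in ~` V).
  move=> uv [/set_mem Vu /set_mem nVv].
  have : closure [set v] u by rewrite -uv; exact: subset_closure.
  by case/(_ V Vu) => w [->].
by case; apply: half.
Qed.

Theorem spectral_space_patch_limit : spectral_space T.
Proof.
split=> //.
- exact: patch_closed_compact.
(* The intersection is compact because each [V i] is patch-closed and this passes to intersections;
   it is open because the index set is finite. *)
- move=> n V qcV; split.
    apply: patch_closed_compact => U x UU Ux UV i _.
    apply: (compact_patch_closed (qcV i) UU Ux).
    by apply: filterS UV => w; apply.
  rewrite openE => x Vx; rewrite /interior.
  have : \forall y \near x, forall i, V i y.
    apply: filter_forall => i; apply: open_nbhs_nbhs.
    by split; [case: (qcV i) | exact: Vx].
  by apply: filterS => y Vy i _.
- split=> [W []//|x O /basis_nbhs[V [BV Vx VO]]].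
  by exists V => //; split=> //; exact: basis_qc_open.
- move=> F F0 Firr Fcl; have [x xF] := irreducible_generic F0 Firr Fcl.
  by exists x; split=> // y yF; apply: kolmogorov_closure_inj; rewrite xF.
Qed.

End UltrafilterCriterion.

Section HullKernel.
Variables (A : choiceType) (X : set (hull_kernel A)).

Definition hull_kernel_subbase (F : set A) : set (hull_kernel A) :=
  [set I : set A | ~ F `<=` I].

Definition hull_kernel_base : set (set X) :=
  preimage val @` finI_from (@finite_set A) hull_kernel_subbase.

(* Casts from [hull_kernel A] back to [set A]. *)
Definition hull_set (x : X) : set A := set_val x.

Lemma hull_kernel_base_basis : basis hull_kernel_base.
Proof.
split=> [_ [W BW <-]|x W].
  (* Open sets of the generated topology are unions of families of finite intersections; here the
     family is a singleton. *)
  exists W => //; exists [set W]; first by move=> _ ->.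
  by rewrite bigcup_set1.
rewrite nbhsE => -[_ [[_ [C CB <-] <-] [V CV Vx]] CO].
exists (val @^-1` V); first by split=> //; exists V => //; exact: CB.
by move=> y Vy; apply: CO; exists V.
Qed.

(** Two distinct sets differ at some [a], and [D({a})] contains the one that lacks [a] and misses
    the other. *)
Lemma hull_kernel_kolmogorov : kolmogorov_space X.
Proof.
have sep (x y : X) (a : A) : hull_set x a -> ~ hull_set y a ->
    exists2 O, nbhs y O & ~ O x.
  move=> xa ya; exists (val @^-1` hull_kernel_subbase [set a]); last first.
    by apply=> _ ->.
  apply: open_nbhs_nbhs; split; last by apply/existsNP; exists a => /(_ erefl).
  apply: (basis_open hull_kernel_base_basis).
  exists (hull_kernel_subbase [set a]) => //; apply: finI_from1.
  exact: finite_set1.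
move=> x y /eqP xy; apply: contrapT => H; apply: xy; apply: val_inj.
by apply/seteqP; split=> a ha; apply: contrapT => na; apply: H;
  have [W nW Wx] := sep _ _ _ ha na; exists W; [right|left];
  split; apply/mem_set.
Qed.

Lemma ultra_finite_subset (U : set_system X) (F : set A) :
    UltraFilter U -> finite_set F ->
  U [set I : X | F `<=` hull_set I] <->
  F `<=` [set a | U [set I : X | hull_set I a]].
Proof.
move=> UU /finite_fsetP[E ->]; split=> [UE a Ea|UE].
  by apply: filterS UE => I; apply.
exact: (filter_bigI (f := fun a => [set I : X | hull_set I a]) _ UE).
Qed.

(** Membership of [I] in a basic open set is a finite Boolean combination of conditions
    [hull_set I a], and an ultrafilter commutes with negation and finite conjunction. *)
Lemma hull_kernel_patch_limit (U : set_system X) (L : X) :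
    UltraFilter U ->
    hull_set L = [set a | U [set I : X | hull_set I a]] ->
  patch_limit hull_kernel_base U L.
Proof.
move=> UU LE.
have sub F : finite_set F ->
    U (val @^-1` hull_kernel_subbase F) <-> hull_kernel_subbase F (hull_set L).
  move=> Ffin; rewrite /hull_kernel_subbase /= LE -ultra_finite_subset //.
  exact: (ultra_setC [set I : X | F `<=` hull_set I] UU).
move=> _ [_ [E Efin <-] <-]; split=> [UE F EF|LF].
  apply/sub; first by have := Efin _ EF; rewrite inE.
  by apply: filterS UE => I; apply.
have UF (F : set A) : F \in E -> U (val @^-1` hull_kernel_subbase F).
  by move=> EF; apply/sub; [have := Efin _ EF; rewrite inE | exact: LF].
exact: (filter_bigI _ UF).
Qed.

End HullKernel.

Section ClosedIdeals.
Variable A : comPzSemiRingType.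
Implicit Types I J : ideal A.

Lemma idealP I : is_ideal I.
Proof. by case: I => I /= /asboolP. Qed.

Lemma ideal_leP I J : (I <= J)%O <-> ideal_set I `<=` J.
Proof. by rewrite leEsub subsetEset. Qed.

Variable cl : ideal A -> ideal A.
Hypothesis cl_closure : closure_operation cl.
Hypothesis cl_finite_type : finite_type cl.

(** Each ideal axiom derives one membership from at most two others, so it passes from the points of
    the space to the limit. *)
Lemma closed_ideals_ultra (U : set_system (closed_ideals cl)) :
    UltraFilter U ->
  closed_ideals cl [set a | U [set I | hull_set I a]].
Proof.
move=> UU; set L := (X in closed_ideals cl X).
have hull_setP (x : closed_ideals cl) :
    exists2 I, cl I = I & ideal_set I = hull_set x by exact: (set_valP x).
have LP : is_ideal L.
  split=> [|a b La Lb|a b Lb].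
  - apply: filterE => x /=; have [I _ <-] := hull_setP x.
    by have [] := idealP I.
  - apply: filterS (filterI La Lb) => x /=; have [I _ <-] := hull_setP x.
    by have [_ Iadd _] := idealP I => -[]; exact: Iadd.
  - apply: filterS Lb => x /=; have [I _ <-] := hull_setP x.
    by have [_ _ Imul] := idealP I; exact: Imul.
exists (Ideal (asboolT LP)) => //=.
case: cl_closure => cl_ge _ cl_homo.
apply/le_anti; rewrite cl_ge andbT; apply/ideal_leP => a /=.
(* Finite type puts [a] in [cl J] for some [J] inside [L] generated by a finite [F]. Almost every
   [I] contains [F]; such an [I] contains [J], hence also [cl J], because [cl I = I]. *)
rewrite cl_finite_type => -[J [/ideal_leP /= JL [F Ffin JF]] clJa].
have FL : F `<=` L.
  by apply: subset_trans JL; rewrite JF; exact: sub_gen_smallest.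
apply: filterS (proj2 (ultra_finite_subset UU Ffin) FL) => x /=.
have [I clI <-] := hull_setP x => FI.
suff /ideal_leP : (cl J <= I)%O by apply.
rewrite -clI; apply: cl_homo; apply/ideal_leP; rewrite JF.
by apply: smallest_sub => //; exact: idealP.
Qed.

End ClosedIdeals.

Theorem proposition3p9 (A : comPzSemiRingType) (cl : ideal A -> ideal A)
    (cl_closure : closure_operation cl) (cl_finite_type : finite_type cl) :
  spectral_space (set_type (closed_ideals cl)).
Proof.
apply: (spectral_space_patch_limit (@hull_kernel_kolmogorov _ _)
  (@hull_kernel_base_basis _ _)) => U UU.
have clU := closed_ideals_ultra cl_closure cl_finite_type UU.
exists (SigSub (mem_set clU)); exact: hull_kernel_patch_limit.
Qed.
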